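(* Let $\mathcal S=\{S_1,\dots,S_m\}$ be an iterated function system of contraction similitudes of $\mathbb R^n$ with ratios $c_1,\dots,c_m\in(0,1)$, and let $s$ be its similarity dimension, i.e. the unique solution of $\sum_{i=1}^m c_i^s=1$. If $F\subseteq\mathbb R^n$ is a $\delta$-quasi-self-similar set with the system $\mathcal S$ satisfying the open set condition, then $$\dim_H F=\dim_B F=s\quad\text{and}\quad 0<\mathcal H^s(F)<+\infty .$$
   Context: Here $\dim_H$ is Hausdorff dimension, $\dim_B$ box dimension, $\mathcal H^s$ $s$-dimensional Hausdorff measure. $\mathcal I=\mathcal I(m)$ is the set of finite words $\mathbf i=i_1\cdots i_k$ with letters in $\{1,\dots,m\}$, including the empty word $\mathbf 0$ of length $0$; $|\mathbf i|=k$ is the length. A word is identified with the cylinder of all infinite words in $\{1,\dots,m\}^{\infty}$ extending it, so $\mathbf i\supseteq\mathbf j$ means $\mathbf i$ is a prefix of $\mathbf j$ and $\mathbf i\cap\mathbf j=\emptyset$ means neither word is a prefix of the other. For $\mathbf i=i_1\cdots i_k$: $S_{\mathbf i}=S_{i_1}\circ\cdots\circ S_{i_k}$, $S_{\mathbf 0}=\mathrm{id}$, $c_{\mathbf i}=c_{i_1}\cdots c_{i_k}$, $c_{\mathbf 0}=1$, where $|S_i(x)-S_i(y)|=c_i|x-y|$. $E$ is the nonempty compact set with $E=\bigcup_{i=1}^m S_i(E)$, and $E_{\mathbf i}=S_{\mathbf i}(E)$. For nonempty $A,B\subseteq\mathbb R^n$, $h(A,B)$ is the Hausdorff distance, $\widetilde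 h(A,B)=\inf\{h(\varphi(A),\psi(B)):\varphi,\psi\text{ isometries of }\mathbb R^n\}$, and $\mathrm r(A)=\inf_{x\in\mathbb R^n}\sup_{a\in A}|x-a|$ is the radius. A structure system of $F$ is a family $\{F_{\mathbf i}:\mathbf i\in\mathcal I\}$ of nonempty compact subsets of $\mathbb R^n$ with $F_{\mathbf 0}=F$ and $F_{\mathbf i}=\bigcup_{i=1}^m F_{\mathbf i i}$ for all $\mathbf i\in\mathcal I$. $F$ (with such a structure system) is a $\delta$-quasi-self-similar set with $\mathcal S$ (also called a $\delta$-perturbation of $E$) if there are numbers $\delta_{\mathbf i}\ge0$ with $\delta=\sup_{\mathbf i}\delta_{\mathbf i}<+\infty$ and $\widetilde h(F_{\mathbf i},E_{\mathbf i})\le\delta_{\mathbf i}c_{\mathbf i}\,\mathrm r(E)$ for all $\mathbf i\in\mathcal I$. $F$ satisfies the open set condition if there is a family $\{V_{\mathbf i}:\mathbf i\in\mathcal I\}$ of open subsets of $\mathbb R^n$ such that: (1) $F_{\mathbf i}\subseteq\mathrm{cl}(V_{\mathbf i})$ for all $\mathbf i$; (2) $V_{\mathbf i}\cap V_{\mathbf j}=\emptyset$ whenever $\mathbf i\cap\mathbf j=\emptyset$; (3) there are constants $a_1,a_2>0$ such that each $V_{\mathbf i}$ contains a ball of radius $a_1c_{\mathbf i}$ and is contained in a ball of radius $a_2c_{\mathbf i}$. *)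

(* Defs.v *)
From mathcomp Require Import all_boot all_order all_algebra.
From mathcomp Require Import all_classical all_reals all_analysis.

Set Implicit Arguments.
Unset Strict Implicit.
Unset Printing Implicit Defensive.

Import Order.TTheory GRing.Theory Num.Theory.
Import numFieldNormedType.Exports.

Local Open Scope classical_set_scope.
Local Open Scope ring_scope.

Section EuclideanGeometry.
Context {R : realType} {n : nat}.
Implicit Types (A B : set 'rV[R]_n) (x y : 'rV[R]_n) (s r : R).

(* The library norm on 'rV[R]_n is the sup norm. It induces the same topology
   as the Euclidean norm, so the library's [open], [closure] and [compact] are
   used as they are, but every metric notion below is Euclidean. *)
Definition enorm x : R := Num.sqrt (\sum_(i < n) x 0 i ^+ 2).

Definition eball x r : set 'rV[R]_n := [set y | enorm (x - y) < r].

(* On R^n a distance-preserving self-map is automatically bijective. *)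
Definition is_isometry (phi : 'rV[R]_n -> 'rV[R]_n) : Prop :=
  forall x y, enorm (phi x - phi y) = enorm (x - y).

(* diam set0 = -oo *)
Definition diam A : \bar R :=
  ereal_sup [set (enorm (p.1 - p.2))%:E | p in A `*` A].

Definition radius A : \bar R :=
  ereal_inf [set ereal_sup [set (enorm (x - a))%:E | a in A] | x in setT].

Definition dist_to A x : \bar R :=
  ereal_inf [set (enorm (x - a))%:E | a in A].

Definition hausdorff_dist A B : \bar R :=
  maxe (ereal_sup [set dist_to B a | a in A])
       (ereal_sup [set dist_to A b | b in B]).

Definition iso_hausdorff_dist A B : \bar R :=
  ereal_inf [set d | exists phi psi, [/\ is_isometry phi, is_isometry psi
                     & d = hausdorff_dist (phi @` A) (psi @` B)]].

(* diam(A)^s, with 0^0 = 1 for singletons and the value 0 for the empty set,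
   so that H^0 is the counting measure. *)
Definition gauge s A : \bar R :=
  if A == set0 then 0%E else (diam A `^ s)%E.

(* Empty sets are allowed in the covers, so this includes finite covers. *)
Definition hausdorff_content s r A : \bar R :=
  ereal_inf [set (\sum_(k <oo) gauge s (U k))%E | U in
    [set U : nat -> set 'rV[R]_n |
      (forall k, diam (U k) <= r%:E)%E /\ A `<=` \bigcup_k U k]].

Definition hausdorff_measure s A : \bar R :=
  ereal_sup [set hausdorff_content s r A | r in [set r : R | 0 < r]].

Definition hausdorff_dim A : \bar R :=
  ereal_inf [set t%:E | t in [set t : R |
    0 <= t /\ hausdorff_measure t A = 0%E]].

(* Least number of sets of diameter at most r covering A
   (+oo if no finite cover exists). *)
Definition covering_number A r : \bar R :=
  ereal_inf [set (k%:R)%:E | k in [set k : nat |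
    exists U : 'I_k -> set 'rV[R]_n,
      (forall i, diam (U i) <= r%:E)%E /\ A `<=` \bigcup_i U i]].

Definition box_ratio A r : \bar R :=
  (lne (covering_number A r) * ((- ln r)^-1)%:E)%E.

Definition lower_box_dim A : \bar R := limf_einf (box_ratio A) (0 : R)^'+.

Definition upper_box_dim A : \bar R := limf_esup (box_ratio A) (0 : R)^'+.

(* The box dimension of A exists and equals d. *)
Definition has_box_dim A (d : \bar R) : Prop :=
  lower_box_dim A = d /\ upper_box_dim A = d.

End EuclideanGeometry.

Definition word (m : nat) : Type := seq 'I_m.

Section QuasiSelfSimilar.
Context {R : realType} {n m : nat}.
Implicit Types (S : 'I_m -> 'rV[R]_n -> 'rV[R]_n) (c : 'I_m -> R)
  (E F : set 'rV[R]_n) (Fs : word m -> set 'rV[R]_n) (w v : word m).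

Definition contraction_similitudes S c : Prop :=
  forall i, 0 < c i < 1 /\
    forall x y, enorm (S i x - S i y) = c i * enorm (x - y).

Definition similarity_dimension c (s : R) : Prop :=
  \sum_(i < m) c i `^ s = 1.

Definition self_similar_set S E : Prop :=
  [/\ E !=set0, compact E & E = \bigcup_i (S i @` E)].

(* S_{i_1} o ... o S_{i_k} for w = [:: i_1; ...; i_k] *)
Definition word_map S w : 'rV[R]_n -> 'rV[R]_n := fun x => foldr S x w.

Definition word_ratio c w : R := \prod_(i <- w) c i.

(* The cylinders of v and w are disjoint. *)
Definition incomparable v w : bool := ~~ prefix v w && ~~ prefix w v.

Definition structure_system F Fs : Prop :=
  [/\ forall w, Fs w !=set0 /\ compact (Fs w),
      Fs [::] = F
    & forall w, Fs w = \bigcup_i Fs (rcons w i)].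

Definition quasi_self_similar S c E (delta : R) F Fs : Prop :=
  structure_system F Fs /\
  exists d : word m -> R,
    [/\ forall w, 0 <= d w,
        ereal_sup (range (fun w => (d w)%:E)) = delta%:E
      & forall w, (iso_hausdorff_dist (Fs w) (word_map S w @` E)
                   <= (d w * word_ratio c w)%:E * radius E)%E].

Definition open_set_condition c Fs : Prop :=
  exists V : word m -> set 'rV[R]_n,
    [/\ forall w, open (V w),
        forall w, Fs w `<=` closure (V w),
        forall v w, incomparable v w -> V v `&` V w = set0
      & exists a1 a2 : R, [/\ 0 < a1, 0 < a2
          & forall w,
              (exists x, eball x (a1 * word_ratio c w) `<=` V w) /\
              (exists y, V w `<=` eball y (a2 * word_ratio c w))]].

End QuasiSelfSimilar.

(* Main.v *)
Require Import Defs.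
From mathcomp Require Import all_boot all_order all_algebra.
From mathcomp Require Import all_classical all_reals all_analysis.
From mathcomp Require Import finmap ring lra.

(** Write c_w for the ratio of a word w. The open set condition confines every
    piece F_w to a set of diameter comparable with c_w, and since c_w^s is
    multiplicative with sum 1 over the letters, the words of each length carry
    total mass 1 when w has mass c_w^s.

    Upper bounds. The pieces of one length cover F, and the sum of the s-th
    powers of their diameters is at most a constant; letting the length grow
    gives H^s(F) < +oo ([hausdorff_content_upper]). Choosing instead, along
    every infinite word, the first prefix of ratio at most a multiple of r
    gives a cover of F by pieces of size about r. These prefixes have disjoint
    cylinders of mass about r^s, so there are at most of the order of r^(-s) of
    them ([covering_number_upper]).

    Lower bounds. A set U of diameter d meets only boundedly many pieces of size
    about d, because the disjoint open sets of these pieces contain disjoint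
    balls of radius comparable with d, all near U ([stop_count_bound]). Hence U
    captures a mass of at most N d^s. Any finite cover of F captures all the
    mass, so the sum of d^s over the cover is at least 1/N
    ([finite_cover_sum]). Applied to sets of equal diameter this bounds the
    covering number from below ([covering_number_lower]); with compactness of F,
    which turns countable covers into finite ones, it gives H^s(F) > 0
    ([hausdorff_content_lower]). The mass only has to be distributed over the
    words of one large finite length, so no measure on F is constructed.

    The two kinds of bounds determine both dimensions. *)

Set Implicit Arguments.
Unset Strict Implicit.
Unset Printing Implicit Defensive.

Import Order.TTheory GRing.Theory Num.Theory.
Import numFieldNormedType.Exports.
Local Open Scope classical_set_scope.
Local Open Scope ring_scope.

(** * Weighted covering and packing counts *)

Lemma sum_incidence (R : nmodType) (I J : Type) (W : seq I) (V : seq J)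
    (r : J -> I -> bool) (f : I -> R) :
  \sum_(v <- V) \sum_(w <- W | r v w) f w
  = \sum_(w <- W) f w *+ count (r^~ w) V.
Proof.
rewrite (exchange_big_dep xpredT)//=; apply: eq_bigr => w _.
by rewrite big_const_seq -Monoid.iteropE.
Qed.

Lemma sum_le_cover (R : numDomainType) (I J : eqType) (W : seq I) (V : seq J)
    (Q : pred I) (r : J -> I -> bool) (f : I -> R) :
  (forall w, 0 <= f w) ->
  {in W, forall w, Q w -> has (r^~ w) V} ->
  \sum_(w <- W | Q w) f w <= \sum_(v <- V) \sum_(w <- W | r v w) f w.
Proof.
move=> f0 QV; rewrite sum_incidence big_mkcond/= !big_seq.
apply: ler_sum => w /QV; case: (Q w) => [/(_ isT)|_]; last exact: mulrn_wge0.
by rewrite has_count => ?; apply: (@ler_wpMn2l _ (f w) _ 1).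
Qed.

Lemma sum_disjoint_le (R : numDomainType) (I J : eqType) (W : seq I) (V : seq J)
    (r : J -> I -> bool) (f : I -> R) :
  (forall w, 0 <= f w) -> uniq V ->
  (forall w, {in V &, forall v v', r v w -> r v' w -> v = v'}) ->
  \sum_(v <- V) \sum_(w <- W | r v w) f w <= \sum_(w <- W) f w.
Proof.
move=> f0 uV rV; rewrite sum_incidence ler_sum// => w _.
apply: (@ler_wpMn2l _ (f w) _ _ 1) => //.
have [/hasP[v Vv rv]|] := boolP (has (r^~ w) V).
  rewrite (@eq_in_count _ _ (pred1 v)) ?count_uniq_mem ?leq_b1// => u Vu /=.
  by apply/idP/eqP => [ru|->//]; exact: rV ru rv.
by rewrite has_count lt0n negbK => /eqP ->.
Qed.

(** * Words, cylinder masses and stopping *)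

Fixpoint words (m L : nat) : seq (word m) :=
  if L is L'.+1 then [seq i :: w | i <- enum 'I_m, w <- words m L']
  else [:: [::]].

Lemma mem_words m L (w : word m) : (w \in words m L) = (size w == L).
Proof.
elim: L w => [|L IH] [|i w] //=.
  by apply/allpairsP => -[[? ?] []].
rewrite eqSS -IH; apply/allpairsP/idP => [[[j u]/= [_ uL [_ ->]]]//|wL].
by exists (i, w); rewrite mem_enum.
Qed.

Lemma word_ratio_nil (R : realType) m (c : 'I_m -> R) :
  word_ratio c [::] = 1.
Proof. by rewrite /word_ratio big_nil. Qed.

Lemma word_ratio_cons (R : realType) m (c : 'I_m -> R) i w :
  word_ratio c (i :: w) = c i * word_ratio c w.
Proof. by rewrite /word_ratio big_cons. Qed.

Lemma word_ratio_gt0 (R : realType) m (c : 'I_m -> R) w :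
  (forall i, 0 < c i) -> 0 < word_ratio c w.
Proof. by move=> c0; rewrite /word_ratio prodr_gt0. Qed.

Lemma word_ratio_le_exp (R : realType) m (c : 'I_m -> R) (q : R) w :
  (forall i, 0 < c i <= q) -> word_ratio c w <= q ^+ size w.
Proof.
move=> cq; elim: w => [|i w IH]; first by rewrite word_ratio_nil.
have /andP[ci0 ciq] := cq i; rewrite word_ratio_cons exprS ler_pM//.
  exact: ltW.
by apply/ltW/word_ratio_gt0 => j; have /andP[] := cq j.
Qed.

Lemma sum_words (R : realType) m (c : 'I_m -> R) (s : R) L (P : pred (word m)) :
  (forall i, 0 < c i) ->
  \sum_(w <- words m L.+1 | P w) word_ratio c w `^ s
  = \sum_i c i `^ s *
      \sum_(w <- words m L | P (i :: w)) word_ratio c w `^ s.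
Proof.
move=> c0 /=; rewrite big_mkcond big_allpairs_dep/= big_enum/=.
apply: eq_bigr => i _; rewrite mulr_sumr -big_mkcond/=.
apply: eq_bigr => w _; rewrite word_ratio_cons powRM//; first exact: ltW.
exact/ltW/word_ratio_gt0.
Qed.

Lemma sum_words1 (R : realType) m (c : 'I_m -> R) (s : R) L :
  (forall i, 0 < c i) -> similarity_dimension c s ->
  \sum_(w <- words m L) word_ratio c w `^ s = 1.
Proof.
move=> c0 cs; elim: L => [|L IH].
  by rewrite big_seq1 word_ratio_nil powR1.
by rewrite sum_words// IH; under eq_bigr do rewrite mulr1.
Qed.

(** This plays the role of the self-similar measure giving the cylinder of [v]
    mass c_v^s: the masses of the words of a fixed length [L] form a
    probability distribution that, for every [L], induces these values on all
    cylinders of length at most [L]. *)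
Lemma sum_cylinder (R : realType) m (c : 'I_m -> R) (s : R) L (v : word m) :
  (forall i, 0 < c i) -> similarity_dimension c s -> (size v <= L)%N ->
  \sum_(w <- words m L | prefix v w) word_ratio c w `^ s = word_ratio c v `^ s.
Proof.
move=> c0 cs; elim: v L => [|i v IH] L vL.
  under eq_bigl do rewrite prefix0s.
  by rewrite sum_words1// word_ratio_nil powR1.
case: L vL => // L vL; rewrite sum_words// (bigD1 i)//= [X in _ + X]big1.
  under eq_bigl do rewrite eqxx/=.
  rewrite addr0 IH// word_ratio_cons powRM//; first exact: ltW.
  exact/ltW/word_ratio_gt0.
move=> j ji; rewrite big_pred0 ?mulr0// => w/=.
by rewrite eq_sym (negbTE ji).
Qed.

(** The shortest prefix of [w] whose ratio is at most [d] (or [w] itself if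
    there is none). Dividing the scale by each letter's ratio makes it
    structurally recursive on the word, without mention of prefixes. *)
Fixpoint stop {R : realType} {m} (c : 'I_m -> R) (d : R) (w : word m) : word m :=
  if w is i :: w' then
    if 1 <= d then [::] else i :: stop c (d / c i) w'
  else [::].

Lemma prefix_stop (R : realType) m (c : 'I_m -> R) d w :
  prefix (stop c d w) w.
Proof.
elim: w d => //= i w IH d; case: ifP => // _ /=; by rewrite eqxx IH.
Qed.

(** The decision to stop after a prefix depends only on that prefix. Hence at a
    given scale the stopped prefixes form an antichain of words. *)
Lemma stop_prefix (R : realType) m (c : 'I_m -> R) d v w :
  (forall i, 0 < c i) ->
  word_ratio c v <= d -> prefix (stop c d v) w -> stop c d w = stop c d v.
Proof.
move=> c0; elim: v d w => [|i v IH] d [|j w]//=; rewrite ?word_ratio_nil.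
- by move=> ->.
- by case: ifP.
- rewrite word_ratio_cons => vd; case: ifP => // _ /= /andP[/eqP <- vw].
  congr cons; apply: IH => //.
  by rewrite ler_pdivlMr// mulrC.
Qed.

Lemma word_ratio_stop_le (R : realType) m (c : 'I_m -> R) d w :
  (forall i, 0 < c i) ->
  word_ratio c w <= d -> word_ratio c (stop c d w) <= d.
Proof.
move=> c0; elim: w d => [|i w IH] d //=; rewrite word_ratio_cons => wd.
case: ifP => [|_]; first by rewrite word_ratio_nil.
rewrite word_ratio_cons mulrC -ler_pdivlMr//; apply: IH.
by rewrite ler_pdivlMr// mulrC.
Qed.

(** Stopping overshoots the scale by at most one letter, that is, by at most the
    factor [p]. *)
Lemma word_ratio_stop_ge (R : realType) m (c : 'I_m -> R) (p d : R) w :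
  (forall i, p <= c i) -> 0 < p <= 1 -> d <= 1 ->
  p * d <= word_ratio c (stop c d w).
Proof.
move=> cp /andP[p0 p1]; have c0 i : 0 < c i by apply: lt_le_trans (cp i).
elim: w d => [|i w IH] d d1 /=.
  by rewrite word_ratio_nil; nra.
case: ifPn => [_|]; first by rewrite word_ratio_nil; nra.
rewrite -ltNge => {}d1; rewrite word_ratio_cons.
have [dci|dci] := leP (d / c i) 1.
  by rewrite [leRHS]mulrC -ler_pdivrMr// -mulrA IH.
case: w IH => [|j w] IH /=; rewrite ?(ltW dci) word_ratio_nil mulr1.
  by apply: le_trans (cp i); nra.
by apply: le_trans (cp i); nra.
Qed.

(** * Structure systems and the open set condition *)

Lemma structure_system_sub (R : realType) (n m : nat) (F : set 'rV[R]_n)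
    (Fs : word m -> set 'rV[R]_n) (w u : word m) :
  structure_system F Fs -> Fs (w ++ u) `<=` Fs w.
Proof.
move=> [_ _ FsU]; elim: u w => [|i u IH] w; first by rewrite cats0.
by rewrite -cat_rcons => x /IH Fx; rewrite FsU; exists i.
Qed.

Lemma structure_system_cover (R : realType) (n m : nat) (F : set 'rV[R]_n)
    (Fs : word m -> set 'rV[R]_n) L w x :
  structure_system F Fs -> Fs w x ->
  exists2 u, u \in words m L & Fs (w ++ u) x.
Proof.
move=> [_ _ FsU]; elim: L w => [|L IH] w Fx.
  by exists [::]; rewrite ?cats0.
move: Fx; rewrite FsU => -[i _ /IH[u uL]]; rewrite cat_rcons => Fx.
by exists (i :: u) => //; rewrite mem_words/= eqSS -mem_words.
Qed.

Lemma norm_coord_le (R : realType) n (x : 'rV[R]_n) (r : R) :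
  0 <= r -> (forall j, `|x 0 j| <= r) -> `|x| <= r.
Proof.
move=> r0 xr; rewrite {1}/Num.Def.normr/= mx_normrE; apply: bigmax_le => // -[i j] _/=.
by rewrite (ord1 i).
Qed.

Lemma norm_coord_lt (R : realType) n (x : 'rV[R]_n) (r : R) :
  0 < r -> (forall j, `|x 0 j| < r) -> `|x| < r.
Proof.
move=> r0 xr; rewrite {1}/Num.Def.normr/= mx_normrE; apply/bigmax_ltP; split=> // -[i j] _/=.
by rewrite (ord1 i).
Qed.

Lemma coord_le_norm (R : realType) n (x : 'rV[R]_n) j : `|x 0 j| <= `|x|.
Proof.
rewrite [leRHS]/Num.Def.normr/= mx_normrE.
exact: (le_bigmax 0 (fun ij => `|x ij.1 ij.2|) (0, j)).
Qed.

(** All estimates are carried out in the sup norm, whose triangle inequality and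
    coordinatewise description are at hand. Passing to it from the Euclidean
    norm costs no constant in this direction, and a factor depending only on the
    dimension in the other. *)
Lemma norm_le_enorm (R : realType) n (x : 'rV[R]_n) : `|x| <= enorm x.
Proof.
apply: norm_coord_le => [|j]; first exact: sqrtr_ge0.
rewrite -sqrtr_sqr ler_wsqrtr// (bigD1 j)//= lerDl sumr_ge0// => *.
exact: sqr_ge0.
Qed.

Lemma enorm_le_norm (R : realType) n (x : 'rV[R]_n) :
  enorm x <= n.+1%:R * `|x|.
Proof.
rewrite -[leRHS]ger0_norm ?mulr_ge0// -sqrtr_sqr ler_wsqrtr// exprMn.
apply: (@le_trans _ _ (\sum_(i < n) `|x| ^+ 2)).
  apply: ler_sum => j _; rewrite -real_normK ?num_real//.
  by rewrite lerXn2r ?nnegrE// coord_le_norm.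
rewrite sumr_const card_ord -[leLHS]mulr_natl ler_wpM2r ?sqr_ge0//.
by rewrite -natrX ler_nat expnS expn1 (leq_trans (leqnSn n))// leq_pmulr.
Qed.

Lemma diam_leP (R : realType) n (A : set 'rV[R]_n) (r : R) :
  (diam A <= r%:E)%E <-> forall x y, A x -> A y -> enorm (x - y) <= r.
Proof.
split=> [Ar x y Ax Ay|Ar].
  rewrite -lee_fin; apply: le_trans Ar; apply: ereal_sup_ubound.
  by exists (x, y).
by apply: ge_ereal_sup => _ [[x y]/= [Ax Ay] <-]; rewrite lee_fin Ar.
Qed.

Lemma diam_ge0 (R : realType) n (A : set 'rV[R]_n) :
  A !=set0 -> (0 <= diam A)%E.
Proof.
move=> [x Ax]; apply: ereal_sup_ubound; exists (x, x) => //=.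
rewrite subrr; congr (_%:E).
rewrite /enorm big1 ?sqrtr0// => i _; by rewrite mxE expr0n.
Qed.

Lemma norm_closure_le (R : realType) n (A : set 'rV[R]_n) y (r : R) :
  (forall z, A z -> `|y - z| <= r) -> forall z, closure A z -> `|y - z| <= r.
Proof.
move=> Ar z zA; apply/ler_addgt0Pr => e e0.
have [u [Au zu]] := zA _ (nbhsx_ballx z e e0).
move: zu; rewrite -ball_normE/= => zu.
rewrite -(subrKA u) (le_trans (ler_normD _ _))// lerD ?Ar//.
by rewrite distrC ltW.
Qed.

(** The open set condition in terms of points: the mark [x w] is the centre of a
    ball inside the open set of [w]. Distances are in the sup norm. *)
Definition marked {R : realType} {n m : nat} (c : 'I_m -> R)
    (Fs : word m -> set 'rV[R]_n) (a b : R) (x : word m -> 'rV[R]_n) : Prop :=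
  (forall w p, Fs w p -> `|p - x w| <= b * word_ratio c w) /\
  (forall v w, incomparable v w -> a * word_ratio c v <= `|x v - x w|).

Lemma open_set_condition_marked (R : realType) (n m : nat) (c : 'I_m -> R)
    (Fs : word m -> set 'rV[R]_n) :
  (forall i, 0 < c i) -> open_set_condition c Fs ->
  exists a b x, [/\ 0 < a, 0 < b & marked c Fs a b x].
Proof.
move=> c0 [V [_ FV Vdisj [a [b [a0 b0 Vball]]]]].
have [x xV] := choice (fun w => (Vball w).1).
have [y Vy] := choice (fun w => (Vball w).2).
have Vx w : V w (x w).
  apply: xV; rewrite /eball/= subrr.
  apply: le_lt_trans (enorm_le_norm _) _.
  by rewrite normr0 mulr0 mulr_gt0// word_ratio_gt0.
exists (a / n.+1%:R), (2 * b), x; split; [by rewrite divr_gt0|by rewrite mulr_gt0|].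
split=> [w p Fp|v w vw].
  have Vyw z : V w z -> `|y w - z| <= b * word_ratio c w.
    move=> /Vy; rewrite /eball/= => /ltW yz.
    exact: le_trans (norm_le_enorm _) yz.
  have yp : `|y w - p| <= b * word_ratio c w.
    by apply: (@norm_closure_le _ _ (V w)) => //; exact: FV.
  rewrite -(subrKA (y w)) (le_trans (ler_normD _ _))// distrC.
  by rewrite -mulrA mulr_natl mulr2n lerD// Vyw.
rewrite mulrAC ler_pdivrMr// [leRHS]mulrC; apply: le_trans (enorm_le_norm _).
rewrite leNgt; apply/negP => xvw.
have : (V v `&` V w) (x w) by split => //; apply: xV; exact: xvw.
by rewrite Vdisj.
Qed.

(** Points of a cube that are [r] apart occupy distinct cells of the grid of
    mesh [r], because two points of one cell are less than [r] apart in the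
    sup norm. The number of cells depends only on the ratio of the side of the
    cube to [r]. *)
Lemma packing_bound (R : realType) (n : nat) (T : eqType) (V : seq T)
    (x : T -> 'rV[R]_n) (q : 'rV[R]_n) (r B : R) :
  0 < r -> uniq V ->
  {in V, forall v, `|x v - q| <= B * r} ->
  {in V &, forall v v', v != v' -> r <= `|x v - x v'|} ->
  (size V <= (Num.truncn (2 * B)).+1 ^ n)%N.
Proof.
move=> r0 uV xq xx; set K := Num.truncn (2 * B).
pose t v j := (x v 0 j - q 0 j) / r + B.
pose cell v : {ffun 'I_n -> 'I_K.+1} := [ffun j => inord (Num.truncn (t v j))].
have tB v j : v \in V -> 0 <= t v j <= 2 * B.
  move=> /xq vq; have := le_trans (coord_le_norm (x v - q) j) vq.
  rewrite !mxE ler_norml => /andP[Bx xB]; rewrite /t -lerBlDr sub0r.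
  rewrite ler_pdivlMr// mulNr Bx/= -lerBrDr ler_pdivrMr//.
  by rewrite mulr_natl mulr2n addrK.
have cellE v j : v \in V -> cell v j = Num.truncn (t v j) :> nat.
  move=> /(tB _ j)/andP[_ tv]; rewrite ffunE inordK// ltnS; exact: le_truncn.
(* Equal cells force all coordinate differences to be less than r. *)
have cell_inj : {in V &, injective cell}.
  move=> v w vV wV vw; apply/eqP/negPn/negP => /(xx _ _ vV wV).
  apply/negP; rewrite -ltNge; apply: norm_coord_lt => // j.
  have /andP[/truncn_itv tv _] := tB v j vV.
  have /andP[/truncn_itv tw _] := tB w j wV.
  rewrite -(cellE _ _ vV) vw (cellE _ _ wV) in tv.
  have -> : (x v - x w) 0 j = (t v j - t w j) * r.
    by rewrite !mxE /t; field; rewrite gt_eqF.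
  rewrite normrM (gtr0_norm r0) gtr_pMl// ltr_norml -natr1 in tv tw *.
  lra.
have -> : size V = size (map cell V) by rewrite size_map.
rewrite -[X in (_ <= X ^ _)%N](card_ord K.+1) -[X in (_ <= _ ^ X)%N](card_ord n).
rewrite -card_ffun cardE uniq_leq_size// ?map_inj_in_uniq// => z _.
by rewrite mem_enum.
Qed.

(** * The mass of a set of given diameter *)

Lemma ratio_bounds (R : realType) m (c : 'I_m -> R) :
  (forall i, 0 < c i < 1) ->
  exists p q, [/\ 0 < p <= 1, 0 <= q < 1 & forall i, p <= c i <= q].
Proof.
move=> c01; exists (\big[Order.min/1]_i c i), (\big[Order.max/0]_i c i).
rewrite bigmin_le_id bigmax_ge_id; split.
- rewrite andbT; apply/bigmin_gtP; split=> // i _; by have /andP[] := c01 i.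
- apply/bigmax_ltP; split=> // i _; by have /andP[] := c01 i.
- by move=> i; rewrite bigmin_le/= le_bigmax.
Qed.

Lemma exists_expr_le (R : realType) (q d : R) :
  0 <= q < 1 -> 0 < d -> exists L, q ^+ L <= d.
Proof.
move=> /andP[q0 q1] d0.
have /cvgrPdist_le/(_ _ d0)[L _ /(_ L (leqnn L))]/= : q ^+ n @[n --> \oo] --> 0.
  by apply: cvg_expr; rewrite ger0_norm.
by rewrite sub0r normrN ger0_norm ?exprn_ge0// => qL; exists L.
Qed.

Lemma stop_incomparable (R : realType) m (c : 'I_m -> R) d v w :
  (forall i, 0 < c i) -> word_ratio c v <= d -> word_ratio c w <= d ->
  stop c d v != stop c d w -> incomparable (stop c d v) (stop c d w).
Proof.
move=> c0 vd wd; apply: contraNT; rewrite /incomparable -negb_or negbK.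
move=> /orP[]/prefix_trans/(_ (prefix_stop _ _ _)) pvw.
  by rewrite (stop_prefix c0 vd pvw).
by rewrite (stop_prefix c0 wd pvw).
Qed.

(** The number of pieces of size about [d] that meet a set of diameter [d] is
    bounded independently of [d]: their marks lie in a cube of side comparable
    with [d], and their mutual distances are comparable with [d], because the
    balls around them lie in disjoint open sets. *)
Lemma stop_count_bound (R : realType) n m (c : 'I_m -> R)
    (Fs : word m -> set 'rV[R]_n) (p : R) :
  (forall i, 0 < c i) -> 0 < p -> open_set_condition c Fs ->
  exists N : nat, forall d (U : set 'rV[R]_n) (V : seq (word m)),
    0 < d -> (forall y z, U y -> U z -> `|y - z| <= d) -> uniq V ->
    {in V, forall v, p * d <= word_ratio c v <= d /\ Fs v `&` U !=set0} ->
    {in V &, forall v w, v != w -> incomparable v w} ->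
  (size V <= N)%N.
Proof.
move=> c0 p0 /(open_set_condition_marked c0)[a [b [x [a0 b0 [Fx xx]]]]].
exists ((Num.truncn (2 * ((b + 1) / (a * p)))).+1 ^ n)%N.
move=> d U V d0 Ud uV VU Vinc.
have [->//|[v0 v0V]] : V = [::] \/ exists v, v \in V.
  by case: V {uV VU Vinc} => [|v V]; [left|right; exists v; rewrite mem_head].
have [_ [q [_ Uq]]] := VU _ v0V.
apply: (@packing_bound _ _ _ V x q (a * p * d)) => //.
- by rewrite !mulr_gt0.
- move=> v /VU[/andP[_ vd] [y [/Fx yv Uy]]].
  have -> : (b + 1) / (a * p) * (a * p * d) = b * d + d.
    by field; rewrite !gt_eqF.
  rewrite -(subrKA y) (le_trans (ler_normD _ _))// lerD ?Ud// distrC.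
  by rewrite (le_trans yv)// ler_wpM2l// ltW.
- move=> v w vV wV /(Vinc _ _ vV wV)/xx; apply: le_trans.
  by rewrite -mulrA ler_wpM2l ?(ltW a0)//; have [/andP[]] := VU _ vV.
Qed.

(** The mass distribution principle in finite form. Fix a length [L] so large
    that the words of length [L] are finer than every scale [d i]. A word of
    length [L] whose piece meets [U i] runs through one of the boundedly many
    words stopped at scale [d i] whose pieces meet [U i], and each of these
    carries mass at most [d i `^ s]. So [U i] accounts for mass at most a
    constant times [d i `^ s], while the whole cover accounts for mass 1. *)
Lemma finite_cover_sum (R : realType) n m (c : 'I_m -> R) (s : R)
    (F : set 'rV[R]_n) (Fs : word m -> set 'rV[R]_n) :
  (forall i, 0 < c i < 1) -> similarity_dimension c s -> 0 <= s ->
  structure_system F Fs -> open_set_condition c Fs ->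
  exists2 N : R, 0 < N & forall (T : eqType) (I : seq T)
      (U : T -> set 'rV[R]_n) (d : T -> R),
    (forall i, 0 < d i) ->
    (forall i y z, U i y -> U i z -> `|y - z| <= d i) ->
    (forall y, F y -> exists2 i, i \in I & U i y) ->
  1 <= N * \sum_(i <- I) d i `^ s.
Proof.
move=> c01 cs s0 Fsys osc; have c0 i : 0 < c i by have /andP[] := c01 i.
have [p [q [/andP[p0 p1] q01 cpq]]] := ratio_bounds c01.
have [N HN] := stop_count_bound c0 p0 osc.
exists N.+1%:R => // T I U d d0 Ud FU.
(* Stopping at a scale above 1 gives the empty word, whose ratio 1 is not
   comparable with the scale; but one such set already makes the sum large. *)
have [/hasP[i iI di1]|/hasPn d1] := boolP (has (fun i => 1 < d i) I).
  rewrite -[leLHS]mulr1 ler_pM// ?ler1n//.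
  rewrite (big_rem i)//= -[leLHS]addr0 lerD ?sumr_ge0//.
    have := @ge0_ler_powR _ s s0 1 (d i); rewrite !nnegrE powR1 => -> //; exact: ltW.
  by move=> *; exact: powR_ge0.
have [L Ld] : exists L, forall i, i \in I -> q ^+ L <= d i.
  have d'0 : 0 < \big[Order.min/1]_(i <- I) d i.
    by elim/big_ind : _ => // u v u0 v0; rewrite lt_min u0.
  have [L Ld] := exists_expr_le q01 d'0; exists L => i iI.
  by apply: (le_trans Ld); exact: ge_bigmin_seq.
pose W := words m L.
have Wd i w : i \in I -> w \in W -> word_ratio c w <= d i.
  move=> iI; rewrite mem_words => /eqP wL; apply: le_trans (Ld _ iI).
  by rewrite -wL; apply: word_ratio_le_exp => j; rewrite c0/=; case/andP: (cpq j).
pose meets i w := `[< Fs w `&` U i !=set0 >].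
rewrite -[leLHS](sum_words1 L c0 cs) -/W.
have wt0 w : 0 <= word_ratio c w `^ s by exact: powR_ge0.
have cover1 := @sum_le_cover _ _ _ W I predT meets _ wt0.
apply: (le_trans (cover1 _)) => {cover1}.
  move=> w wW _; have [Fne Fnil _] := Fsys.
  have [y Fy] := (Fne w).1.
  have /FU[i iI Uiy] : F y.
    rewrite -Fnil; exact: (structure_system_sub (w := [::]) (u := w) Fsys).
  by apply/hasP; exists i => //; apply/asboolP; exists y.
rewrite mulr_sumr big_seq [leRHS]big_seq ler_sum// => i iI.
pose V := undup [seq stop c (d i) w | w <- W & meets i w].
have VP v : v \in V -> exists w, [/\ w \in W, meets i w & v = stop c (d i) w].
  rewrite mem_undup => /mapP[w]; rewrite mem_filter => /andP[iw wW] ->.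
  by exists w.
have cover2 := @sum_le_cover _ _ _ W V (meets i) (fun v w => prefix v w) _ wt0.
apply: (le_trans (cover2 _)) => {cover2}.
  move=> w wW iw; apply/hasP; exists (stop c (d i) w); last exact: prefix_stop.
  by rewrite mem_undup; apply/mapP; exists w; rewrite ?mem_filter ?iw.
have Vsmall v : v \in V -> word_ratio c v <= d i.
  by move=> /VP[w [wW _ ->]]; apply: word_ratio_stop_le => //; exact: Wd.
apply: (@le_trans _ _ (\sum_(v <- V) d i `^ s)).
  rewrite big_seq [leRHS]big_seq ler_sum// => v vV.
  rewrite sum_cylinder//.
    rewrite ge0_ler_powR// ?nnegrE ?(ltW (d0 i)) ?Vsmall//.
    exact/ltW/word_ratio_gt0.
  have [w [wW _ ->]] := VP _ vV.
  apply: leq_trans (size_prefix (prefix_stop _ _ _)) _.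
  by rewrite mem_words in wW; rewrite (eqP wW).
rewrite big_const_seq count_predT iter_addr addr0 -[leLHS]mulr_natl.
apply: ler_wpM2r; first exact: powR_ge0.

rewrite ler_nat; apply/leqW/(HN (d i) (U i)) => //.
- exact: Ud.
- exact: undup_uniq.
- move=> v vV; split.
    rewrite Vsmall// andbT; have [w [wW _ ->]] := VP _ vV.
    apply: word_ratio_stop_ge => [j||]; first by case/andP: (cpq j).
      by rewrite p0.
    by rewrite leNgt d1.
  have [w [wW /asboolP[y [Fy Uy]] ->]] := VP _ vV; exists y; split => //.
  have /prefixP[u wE] := prefix_stop c (d i) w.
  by rewrite wE in Fy; exact: (structure_system_sub Fsys Fy).
- move=> v v' /VP[w [wW _ ->]] /VP[w' [w'W _ ->]].
  by apply: stop_incomparable => //; exact: Wd.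
Qed.

(** * Hausdorff measure and dimension *)

Lemma similarity_dimension_ge0 (R : realType) m (c : 'I_m -> R) (s : R) :
  (forall i, 0 < c i < 1) -> similarity_dimension c s -> 0 <= s.
Proof.
move=> c01 cs; rewrite leNgt; apply/negP => s0.
have [i _|m0] := pickP (@predT 'I_m); last first.
  by move: cs; rewrite /similarity_dimension big_pred0// => /eqP; rewrite eq_sym oner_eq0.
have /andP[ci0 ci1] := c01 i.
have : c i `^ (- s) < 1 `^ (- s).
  by rewrite gt0_ltr_powR ?oppr_gt0// nnegrE// ltW.
rewrite powR1 powRN invf_lt1 ?powR_gt0// ltNge => /negP; apply.
rewrite -[leRHS]cs (bigD1 i)//= lerDl sumr_ge0// => *; exact: powR_ge0.
Qed.

Lemma ler_powRl (R : realType) (s x y : R) :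
  0 <= s -> 0 <= x -> x <= y -> x `^ s <= y `^ s.
Proof.
by move=> s0 x0 xy; rewrite ge0_ler_powR ?nnegrE// (le_trans x0).
Qed.

Lemma gauge_ge0 (R : realType) n s (A : set 'rV[R]_n) : (0 <= gauge s A)%E.
Proof. by rewrite /gauge; case: ifP => // _; exact: poweR_ge0. Qed.

Lemma diam_fin_num (R : realType) n (A : set 'rV[R]_n) (r : R) :
  A !=set0 -> (diam A <= r%:E)%E -> diam A \is a fin_num.
Proof.
move=> /diam_ge0 A0 Ar; rewrite ge0_fin_numE//; exact: le_lt_trans (ltry r).
Qed.

Lemma gauge_le (R : realType) n (s r : R) (A : set 'rV[R]_n) :
  0 <= s -> (diam A <= r%:E)%E -> (gauge s A <= (r `^ s)%:E)%E.
Proof.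
move=> s0 Ar; rewrite /gauge; case: ifPn => [_|/set0P An0].
  by rewrite lee_fin powR_ge0.
have := diam_ge0 An0; move: (Ar); rewrite -(fineK (diam_fin_num An0 Ar)).
by rewrite poweR_EFin !lee_fin => *; exact: ler_powRl.
Qed.

Lemma gauge_fin_num (R : realType) n (s r : R) (A : set 'rV[R]_n) :
  0 <= s -> (diam A <= r%:E)%E -> gauge s A \is a fin_num.
Proof.
move=> s0 Ar; rewrite ge0_fin_numE ?gauge_ge0//.
exact: le_lt_trans (gauge_le s0 Ar) (ltry _).
Qed.

Lemma enorm_le_gauge (R : realType) n (s r : R) (A : set 'rV[R]_n) x y :
  0 <= s -> (diam A <= r%:E)%E -> A x -> A y ->
  ((enorm (x - y) `^ s)%:E <= gauge s A)%E.
Proof.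
move=> s0 Ar Ax Ay; have An0 : A !=set0 by exists x.
rewrite /gauge ifN; last exact/set0P.
have : (diam A <= (fine (diam A))%:E)%E by rewrite fineK ?(diam_fin_num An0 Ar).
move=> /diam_leP/(_ x y Ax Ay); rewrite -(fineK (diam_fin_num An0 Ar)).
by rewrite poweR_EFin lee_fin => ?; apply: ler_powRl => //; exact: sqrtr_ge0.
Qed.

Lemma le_gauge (R : realType) n (s t : R) (A : set 'rV[R]_n) :
  0 <= t -> t <= s -> (diam A <= 1%:E)%E -> (gauge s A <= gauge t A)%E.
Proof.
move=> t0 ts A1; rewrite /gauge; case: ifPn => [//|/set0P An0].
have := diam_ge0 An0; move: (A1); rewrite -(fineK (diam_fin_num An0 A1)).
rewrite !poweR_EFin !lee_fin => {}A1 A0.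
move: A0; rewrite le_eqVlt => /predU1P[<-|A0]; last by rewrite ger_powR ?A0.
move: t0; rewrite le_eqVlt => /predU1P[<-|t0].
  by rewrite powRr0 /powR eqxx; case: (_ == _).
by rewrite !powR0// gt_eqF// (lt_le_trans t0).
Qed.

Lemma hausdorff_content_le_seq (R : realType) n (s r : R) (A : set 'rV[R]_n)
    (T : eqType) (I : seq T) (U : T -> set 'rV[R]_n) :
  (forall i, i \in I -> (diam (U i) <= r%:E)%E) ->
  (forall x, A x -> exists2 i, i \in I & U i x) ->
  (hausdorff_content s r A <= \sum_(i <- I) gauge s (U i))%E.
Proof.
move=> Ur AU; pose V k := nth set0 (map U I) k.
apply: ge_ereal_inf; exists (\sum_(k <oo) gauge s (V k))%E; last first.
  rewrite (nneseries_split 0 (size (map U I))); last by move=> *; exact: gauge_ge0.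
  rewrite add0n [X in (_ + X)%E]eseries0 ?adde0; last first.
    by move=> k Ik _; rewrite /V nth_default// /gauge eqxx.
  by rewrite -(big_map U xpredT (gauge s)) (big_nth set0).
exists V => //; split=> [k|x /AU[i iI Uix]].
  have [kI|Ik] := ltnP k (size (map U I)).
    have /mapP[i iI] := mem_nth set0 kI.
    by rewrite /V => ->; exact: Ur.
  rewrite /V nth_default//; exact/diam_leP.
exists (index i I) => //; rewrite /V (nth_map i) ?index_mem// nth_index//.
Qed.

(** Compactness reduces countable covers to finite ones. For [0 < s] each set of
    the cover is enlarged to an open set in such a way that the s-th powers of
    the diameters grow by a summable amount of total [e]; a finite subcover is
    then subject to [finite_cover_sum]. The enlarged diameters are
    s-th roots, which excludes [s = 0]; there one nonempty set already
    contributes 1. *)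
Lemma hausdorff_content_lower (R : realType) n m (c : 'I_m -> R) (s : R)
    (F : set 'rV[R]_n) (Fs : word m -> set 'rV[R]_n) :
  (forall i, 0 < c i < 1) -> similarity_dimension c s ->
  structure_system F Fs -> open_set_condition c Fs ->
  exists2 k : R, 0 < k & forall r, (k%:E <= hausdorff_content s r F)%E.
Proof.
move=> c01 cs Fsys osc; have s0 := similarity_dimension_ge0 c01 cs.
have [N N0 HN] := finite_cover_sum c01 cs s0 Fsys osc.
have [Fn0 Fco] : F !=set0 /\ compact F by have [+ <- _] := Fsys; exact.
move: (s0); rewrite le_eqVlt => /predU1P[s0E|s_gt0].
  exists 1 => // r; apply/ereal_infP => _ [U [Ur FU] <-].
  have [x Fx] := Fn0; have [k _ Ukx] := FU x Fx.
  apply: le_trans (nneseries_lim_ge k.+1 _); last by move=> *; exact: gauge_ge0.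
  rewrite big_nat_recr//= -[leLHS]add0e leeD ?sume_ge0//.
    by move=> *; exact: gauge_ge0.
  by rewrite /gauge ifN -?s0E ?poweRe0//; apply/set0P; exists x.
exists N^-1; first by rewrite invr_gt0.
move=> r; apply/ereal_infP => _ [U [Ur FU] <-].
apply/lee_addgt0Pr => e e0.
have g0 k := gauge_ge0 s (U k).
have gfin k : gauge s (U k) \is a fin_num := gauge_fin_num s0 (Ur k).
pose g k := fine (gauge s (U k)); pose u k := g k + e / (2 ^ k.+1)%:R.
have gE k : gauge s (U k) = (g k)%:E by rewrite fineK.
have g_ge0 k : 0 <= g k by rewrite -lee_fin -gE.
have gu k : g k < u k by rewrite ltrDl divr_gt0// ltr0n expn_gt0.
have u0 k : 0 < u k := le_lt_trans (g_ge0 k) (gu k).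
have rootK x : 0 <= x -> (x `^ s^-1) `^ s = x.
  by move=> x0; rewrite -powRrM mulVf ?gt_eqF// powRr1.
(* u k `^ s^-1 is the diameter after enlargement: its s-th power exceeds the
   gauge of U k by exactly e / 2 ^ k.+1. *)
pose eta k := (u k `^ s^-1 - g k `^ s^-1) / 2.
have eta0 k : 0 < eta k.
  by rewrite divr_gt0// subr_gt0 gt0_ltr_powR ?invr_gt0// nnegrE// ltW.
have Ug k y z : U k y -> U k z -> `|y - z| <= g k `^ s^-1.
  move=> Uy Uz; apply: le_trans (norm_le_enorm _) _.
  have := enorm_le_gauge s0 (Ur k) Uy Uz; rewrite gE lee_fin => /(ler_powRl _).
  move=> /(_ s^-1); rewrite -powRrM mulfV ?gt_eqF// powRr1 ?sqrtr_ge0//.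
  by apply; rewrite ?invr_ge0 ?powR_ge0.
pose W k := \bigcup_(y in U k) ball y (eta k).
have Wopen k : setT k -> open (W k).
  by move=> _; apply: bigcup_open => y _; exact: ball_open.
have FW : F `<=` cover setT W.
  move=> y /FU[k _ Uy]; exists k => //; exists y => //; exact: ballxx.
have [D _ FD] : finite_subset_cover setT W F.
  by move: Fco; rewrite compact_cover => /(_ _ setT W Wopen FW).
pose M := (\max_(i <- enum_fset D) i).+1.
have /HN : forall i : nat, 0 < u i `^ s^-1 by move=> i; rewrite powR_gt0.
move=> /(_ (index_iota 0 M) W); rewrite -ler_pdivrMl// mulr1.
under eq_bigr do rewrite (rootK _ (ltW (u0 _))).
move=> NM; apply: le_trans (epsilon_trick xpredT g0 (ltW e0)).
apply: le_trans (nneseries_lim_ge M _); last first.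
  by move=> k _ _; rewrite gE -EFinD lee_fin ltW ?u0.
under eq_bigr do rewrite gE -EFinD.
rewrite sumEFin lee_fin; apply: NM => [k y z [y' Uy yy'] [z' Uz zz']|y Fy].
  move: yy' zz'; rewrite -!ball_normE/= => yy' zz'.
  have -> : u k `^ s^-1 = eta k + (g k `^ s^-1 + eta k) by rewrite /eta; lra.
  rewrite -(subrKA y') (le_trans (ler_normD _ _))// lerD//.
    by rewrite distrC ltW.
  rewrite -(subrKA z') (le_trans (ler_normD _ _))// lerD ?Ug//; exact: ltW.
have [k kD Wk] := FD _ Fy; exists k => //.
by rewrite mem_index_iota/= ltnS; apply: leq_bigmax_seq.
Qed.

Lemma open_set_condition_diam (R : realType) (n m : nat) (c : 'I_m -> R)
    (Fs : word m -> set 'rV[R]_n) :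
  (forall i, 0 < c i) -> open_set_condition c Fs ->
  exists2 D : R, 0 < D & forall w, (diam (Fs w) <= (D * word_ratio c w)%:E)%E.
Proof.
move=> c0 /(open_set_condition_marked c0)[a [b [x [a0 b0 [Fx _]]]]].
exists (n.+1%:R * (2 * b)); first by rewrite !mulr_gt0.
move=> w; apply/diam_leP => y z Fy Fz; apply: le_trans (enorm_le_norm _) _.
rewrite -!mulrA ler_pM2l// -(subrKA (x w)) (le_trans (ler_normD _ _))//.
by rewrite mulr_natl mulr2n lerD ?Fx// distrC Fx.
Qed.

(** The pieces of a sufficiently long fixed length have ratio at most [eta], and
    c_w^t = c_w^(t-s) c_w^s, where the last factors add up to 1. Taking [t = s]
    bounds the measure; for [s < t] the bound tends to 0 with [eta]. *)
Lemma hausdorff_content_upper (R : realType) n m (c : 'I_m -> R) (s t r eta D : R)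
    (F : set 'rV[R]_n) (Fs : word m -> set 'rV[R]_n) :
  (forall i, 0 < c i < 1) -> similarity_dimension c s ->
  structure_system F Fs ->
  0 < D -> (forall w, (diam (Fs w) <= (D * word_ratio c w)%:E)%E) ->
  s <= t -> 0 < eta -> D * eta <= r ->
  (hausdorff_content t r F <= (D `^ t * eta `^ (t - s))%:E)%E.
Proof.
move=> c01 cs Fsys D0 FD st eta0 Dr.
have c0 i : 0 < c i by have /andP[] := c01 i.
have t0 : 0 <= t := le_trans (similarity_dimension_ge0 c01 cs) st.
have [p [q [_ q01 cpq]]] := ratio_bounds c01.
have [L Ld] := exists_expr_le q01 eta0.
have ceta w : w \in words m L -> word_ratio c w <= eta.
  rewrite mem_words => /eqP wL; apply: le_trans Ld; rewrite -wL.
  by apply: word_ratio_le_exp => j; rewrite c0/=; case/andP: (cpq j).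
apply: le_trans (hausdorff_content_le_seq t (I := words m L) (U := Fs) _ _) _.
- move=> w wL; apply: le_trans (FD w) _; rewrite lee_fin (le_trans _ Dr)//.
  by rewrite ler_pM2l// ceta.
- move=> x; have [_ <- _] := Fsys => /(structure_system_cover L Fsys)[u uL Fu].
  by exists u.
rewrite -[leRHS]mule1 -(sum_words1 L c0 cs).
rewrite -sumEFin ge0_sume_distrr; last by move=> *; rewrite lee_fin powR_ge0.
rewrite big_seq [leRHS]big_seq lee_sum// => w wL.
apply: le_trans (gauge_le t0 (FD w)) _; rewrite -EFinM lee_fin.
have w0 := word_ratio_gt0 w c0.
rewrite powRM ?(ltW D0) ?(ltW w0)// -mulrA ler_pM2l ?powR_gt0//.
rewrite -{1}(subrK s t) (@powRD _ (word_ratio c w)); last by rewrite (gt_eqF w0) implybT.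
by rewrite ler_wpM2r ?powR_ge0// ler_powRl ?subr_ge0 ?ceta// ltW.
Qed.

Lemma hausdorff_dim_open_set (R : realType) n m (c : 'I_m -> R) (s : R)
    (F : set 'rV[R]_n) (Fs : word m -> set 'rV[R]_n) :
  (forall i, 0 < c i < 1) -> similarity_dimension c s ->
  structure_system F Fs -> open_set_condition c Fs ->
  hausdorff_dim F = s%:E /\ (0 < hausdorff_measure s F < +oo)%E.
Proof.
move=> c01 cs Fsys osc; have s0 := similarity_dimension_ge0 c01 cs.
have c0 i : 0 < c i by have /andP[] := c01 i.
have [k k0 Fk] := hausdorff_content_lower c01 cs Fsys osc.
have [D D0 FD] := open_set_condition_diam c0 osc.
have le_measure t : (hausdorff_content t 1 F <= hausdorff_measure t F)%E.
  by apply: ereal_sup_ubound; exists 1 => /=.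
split; last first.
  apply/andP; split.
    by apply: lt_le_trans (le_measure s); apply: lt_le_trans (Fk 1); rewrite lte_fin.
  apply: le_lt_trans (ltry (D `^ s)); apply: ge_ereal_sup => _ [r/= r0 <-].
  have rD : D * (r / D) <= r by rewrite mulrC mulfVK ?gt_eqF.
  have := hausdorff_content_upper c01 cs Fsys D0 FD (lexx s) (divr_gt0 r0 D0) rD.
  by rewrite subrr powRr0 mulr1.
apply/eqP; rewrite eq_le; apply/andP; split.
  apply/lee_addgt0Pr => e e0; apply: ereal_inf_lbound.
  exists (s + e); last by rewrite EFinD.
  split; first by rewrite addr_ge0// ltW.
  apply/eqP; rewrite eq_le; apply/andP; split; last first.
    apply: le_trans (le_measure _); apply/ereal_infP => _ [U _ <-].
    by apply: nneseries_ge0 => *; exact: gauge_ge0.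
  apply: ge_ereal_sup => _ [r/= r0 <-]; apply/lee_addgt0Pr => d d0; rewrite add0e.
  (* The second term makes D `^ (s + e) * eta `^ e at most d. *)
  pose eta := Order.min (r / D) ((d / D `^ (s + e)) `^ e^-1).
  have De : 0 < D `^ (s + e) by rewrite powR_gt0.
  have eta0 : 0 < eta by rewrite lt_min divr_gt0// powR_gt0// divr_gt0.
  have rD : D * eta <= r by rewrite mulrC -ler_pdivlMr// ge_min lexx.
  have ss : s <= s + e by rewrite lerDl ltW.
  apply: le_trans (hausdorff_content_upper c01 cs Fsys D0 FD ss eta0 rD) _.
  rewrite lee_fin addrAC subrr add0r mulrC -ler_pdivlMr//.
  have dD0 : 0 <= d / D `^ (s + e) by rewrite divr_ge0// ltW.
  rewrite -[leRHS]powRr1// -(mulVf (lt0r_neq0 e0)) powRrM.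
  by apply: ler_powRl; rewrite ?(ltW e0) ?(ltW eta0)// ge_min lexx orbT.
(* Below s the measure is positive, since lowering the exponent increases the
   gauge of sets of diameter at most 1. *)
apply/ereal_infP => _ [t [t0 Ft] <-]; rewrite lee_fin leNgt; apply/negP => ts.
have : (0 < hausdorff_measure t F)%E.
  apply: lt_le_trans (le_measure t); apply: (@lt_le_trans _ _ k%:E) => //.
  apply: le_trans (Fk 1) _; apply/ereal_infP => _ [U [U1 FU] <-].
  apply: ge_ereal_inf; exists (\sum_(i <oo) gauge s (U i))%E; first by exists U.
  by apply: lee_nneseries => i *; [exact: gauge_ge0|exact: le_gauge (ltW ts) _].
by rewrite Ft ltxx.
Qed.

(** * Box dimension *)

Lemma cvg_limf_esup (R : realType) (G : set_system R) (f : R -> \bar R) (l : R) :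
  ProperFilter G -> f x @[x --> G] --> l%:E -> limf_esup f G = l%:E.
Proof.
move=> PG /fine_cvgP[ffin /cvgrPdist_le fl]; rewrite limf_esupE.
have near_l e : 0 < e -> \forall x \near G, ((l - e)%:E <= f x <= (l + e)%:E)%E.
  move=> /fl; apply: filterS2 ffin => x /fineK <-; rewrite !lee_fin.
  by rewrite ler_distl lerBlDr lerBlDr => /andP[xl lx]; rewrite xl lx.
apply/eqP; rewrite eq_le; apply/andP; split.
  apply/lee_addgt0Pr => e /near_l Ge.
  apply: ge_ereal_inf; exists (ereal_sup (f @` [set x | ((l - e)%:E <= f x <= (l + e)%:E)%E])).
    by eexists; [exact: Ge|].
  by apply: ge_ereal_sup => _ [x /= /andP[_ ?] <-].
apply/ereal_infP => _ [V GV <-]; apply/lee_addgt0Pr => e /near_l Ge.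
have [x [Vx /andP[lx _]]] := filter_ex (filterI GV Ge).
rewrite -leeBlDr//; apply: le_trans lx _.
by apply: ereal_sup_ubound; exists x.
Qed.

Lemma cvg_limf_einf (R : realType) (G : set_system R) (f : R -> \bar R) (l : R) :
  ProperFilter G -> f x @[x --> G] --> l%:E -> limf_einf f G = l%:E.
Proof.
move=> PG fl; rewrite /limf_einf.
rewrite (@cvg_limf_esup _ _ _ (- l))//= ?EFinN ?oppeK//.
exact: cvgeN.
Qed.

Lemma covering_number_lower (R : realType) n m (c : 'I_m -> R) (s : R)
    (F : set 'rV[R]_n) (Fs : word m -> set 'rV[R]_n) :
  (forall i, 0 < c i < 1) -> similarity_dimension c s ->
  structure_system F Fs -> open_set_condition c Fs ->
  exists2 k : R, 0 < k &
    forall r, 0 < r -> ((k * r `^ (- s))%:E <= covering_number F r)%E.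
Proof.
move=> c01 cs Fsys osc; have s0 := similarity_dimension_ge0 c01 cs.
have [N N0 HN] := finite_cover_sum c01 cs s0 Fsys osc.
exists N^-1; first by rewrite invr_gt0.
move=> r r0; apply/ereal_infP => _ [k [U [Ur FU]] <-].
rewrite lee_fin ler_pdivrMl// powRN -[leLHS]mul1r ler_pdivrMr ?powR_gt0//.
have := HN _ (enum 'I_k) U (fun=> r) (fun=> r0).
rewrite big_const_seq count_predT iter_addr addr0 size_enum_ord.
rewrite -mulrA mulr_natl; apply => [i y z Uy Uz|y Fy].
  by apply: le_trans (norm_le_enorm _) _; move/diam_leP: (Ur i); exact.
by have [i _ Ui] := FU y Fy; exists i; rewrite ?mem_enum.
Qed.

(** Words stopped at scale [r / D] have pieces of diameter at most [r]. Their
    cylinders are disjoint and each has mass at least (p r / D)^s, so the total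
    mass 1 bounds their number. *)
Lemma covering_number_upper (R : realType) n m (c : 'I_m -> R) (s : R)
    (F : set 'rV[R]_n) (Fs : word m -> set 'rV[R]_n) :
  (forall i, 0 < c i < 1) -> similarity_dimension c s ->
  structure_system F Fs -> open_set_condition c Fs ->
  exists D K : R, [/\ 0 < D, 0 < K &
    forall r, 0 < r <= D -> (covering_number F r <= (K * r `^ (- s))%:E)%E].
Proof.
move=> c01 cs Fsys osc; have s0 := similarity_dimension_ge0 c01 cs.
have c0 i : 0 < c i by have /andP[] := c01 i.
have [D D0 FD] := open_set_condition_diam c0 osc.
have [p [q [/andP[p0 p1] q01 cpq]]] := ratio_bounds c01.
exists D, ((p / D) `^ (- s)); split => //; first by rewrite powR_gt0 ?divr_gt0.
move=> r /andP[r0 rD]; have rD0 : 0 < r / D by rewrite divr_gt0.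
have [L Ld] := exists_expr_le q01 rD0; pose W := words m L.
have Wr w : w \in W -> word_ratio c w <= r / D.
  rewrite mem_words => /eqP wL; apply: le_trans Ld.
  by rewrite -wL; apply: word_ratio_le_exp => j; rewrite c0/=; case/andP: (cpq j).
pose V := undup [seq stop c (r / D) w | w <- W].
have VP v : v \in V -> exists2 w, w \in W & v = stop c (r / D) w.
  by rewrite mem_undup => /mapP.
have VW w : w \in W -> stop c (r / D) w \in V.
  by move=> wW; rewrite mem_undup map_f.
apply: (@le_trans _ _ (size V)%:R%:E).
  apply: ereal_inf_lbound; exists (size V) => //; exists (fun i => Fs (tnth (in_tuple V) i)).
  split=> [i|y].
    apply: le_trans (FD _) _; rewrite lee_fin mulrC -ler_pdivlMr//.
    have /VP[w wW ->] : tnth (in_tuple V) i \in V by exact: mem_tnth.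
    by apply: word_ratio_stop_le => //; exact: Wr.
  have [_ <- _] := Fsys => /(structure_system_cover L Fsys)[w wW Fy].
  have /VW/(tnthP (in_tuple V))[i iE] := wW; exists i => //; rewrite -iE.
  have /prefixP[u wE] := prefix_stop c (r / D) w.
  by apply: (structure_system_sub (u := u) Fsys); rewrite -wE.
have disj w : {in V &, forall v v', prefix v w -> prefix v' w -> v = v'}.
  move=> v v' /VP[u uW ->] /VP[u' u'W ->] pu pu'.
  by rewrite -(stop_prefix c0 (Wr _ uW) pu) (stop_prefix c0 (Wr _ u'W) pu').
have := @sum_disjoint_le R _ _ W V _ (fun w => word_ratio c w `^ s)
  (fun w => powR_ge0 _ _) (undup_uniq _) disj.
rewrite sum_words1// lee_fin => V1.
have pr0 : 0 < p * (r / D) by rewrite mulr_gt0.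
rewrite -powRM ?(ltW r0) ?divr_ge0 ?(ltW p0) ?(ltW D0)// mulrAC -mulrA powRN.
rewrite -[leRHS]mul1r ler_pdivlMr ?powR_gt0//; apply: le_trans V1.
rewrite mulr_natl -iter_addr_0 -(count_predT V) -big_const_seq.
rewrite big_seq [leRHS]big_seq ler_sum// => v /VP[w wW ->].
rewrite sum_cylinder//.
  apply: ler_powRl => //; first exact: ltW.
  apply: word_ratio_stop_ge => [j||]; first by case/andP: (cpq j).
    by rewrite p0.
  by rewrite ler_pdivrMr// mul1r.
apply: leq_trans (size_prefix (prefix_stop _ _ _)) _.
by rewrite mem_words in wW; rewrite (eqP wW).
Qed.

(** Both bounds on the covering number are constant multiples of r^(-s); after
    taking logarithms and dividing by -ln r, a constant factor [x] contributes
    only ln x / (-ln r), which tends to 0. *)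
Lemma has_box_dim_open_set (R : realType) n m (c : 'I_m -> R) (s : R)
    (F : set 'rV[R]_n) (Fs : word m -> set 'rV[R]_n) :
  (forall i, 0 < c i < 1) -> similarity_dimension c s ->
  structure_system F Fs -> open_set_condition c Fs ->
  has_box_dim F s%:E.
Proof.
move=> c01 cs Fsys osc.
have [k k0 Fk] := covering_number_lower c01 cs Fsys osc.
have [D [K [D0 K0 FK]]] := covering_number_upper c01 cs Fsys osc.
pose b (x r : R) := ((s + ln x * (- ln r)^-1)%:E : \bar R).
have blim x : b x r @[r --> 0^'+] --> s%:E.
  apply: cvg_EFin; first by near=> r.
  rewrite -[X in _ --> X]addr0; apply: cvgD; first exact: cvg_cst.
  rewrite -[X in _ --> X](mulr0 (ln x)); apply: cvgM; first exact: cvg_cst.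
  apply/gtr0_cvgV0; last exact/cvgNry/lnNy.
  near=> r; rewrite oppr_gt0 ln_lt0//.
  by apply/andP; split; near: r; [exact: nbhs_right_gt|exact: nbhs_right_lt].
have bE x r : 0 < x -> 0 < r < 1 ->
    (lne (x * r `^ (- s))%:E * ((- ln r)^-1)%:E = b x r)%E.
  move=> x0 /andP[r0 r1]; have lnr : ln r < 0 by rewrite ln_lt0// r0.
  rewrite lne_EFin ?mulr_gt0 ?powR_gt0// lnM ?posrE ?powR_gt0// ln_powR -EFinM.
  by congr _%:E; field; rewrite lt_eqF.
have lim : box_ratio F r @[r --> 0^'+] --> s%:E.
  apply: squeeze_cvge (blim k) (blim K); near=> r.
  have r0 : 0 < r by near: r; exact: nbhs_right_gt.
  have r1 : r < 1 by near: r; exact: nbhs_right_lt.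
  have rD : r <= D by near: r; exact: nbhs_right_le.
  rewrite -!bE ?r0 ?r1// /box_ratio.
  have lnr0 : (0 <= ((- ln r)^-1)%:E)%E.
    by rewrite lee_fin invr_ge0 oppr_ge0 ltW// ln_lt0// r0.
  have N0 : (0 <= covering_number F r)%E.
    by apply: le_trans (Fk r r0); rewrite lee_fin mulr_ge0 ?powR_ge0// ltW.
  have KN x : 0 < x -> (0 <= (x * r `^ (- s))%:E)%E.
    by move=> x0; rewrite lee_fin mulr_ge0 ?powR_ge0// ltW.
  by rewrite !lee_wpmul2r// lee_lne ?in_itv/= ?leey ?andbT ?KN ?Fk ?FK ?r0 ?rD.
by split; [exact: cvg_limf_einf lim|exact: cvg_limf_esup lim].
Unshelve. all: by end_near.
Qed.

Unset Implicit Arguments.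

Theorem theorem3p2p4 (R : realType) (n m : nat)
    (S : 'I_m -> 'rV[R]_n -> 'rV[R]_n) (c : 'I_m -> R) (s delta : R)
    (E F : set 'rV[R]_n) (Fs : word m -> set 'rV[R]_n)
    (hS : contraction_similitudes S c)
    (hs : similarity_dimension c s)
    (hE : self_similar_set S E)
    (hF : quasi_self_similar S c E delta F Fs)
    (hosc : open_set_condition c Fs) :
  [/\ hausdorff_dim F = s%:E,
      has_box_dim F s%:E
    & (0 < hausdorff_measure s F < +oo)%E].
Proof.
have c01 i : 0 < c i < 1 by have [] := hS i.
have [Fsys _] := hF.
have [dimF measF] := hausdorff_dim_open_set c01 hs Fsys hosc.
by split=> //; exact: has_box_dim_open_set c01 hs Fsys hosc.
Qed.
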